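(* Let $n\ge 1$ be an integer and let $k$ be an odd integer with $1\le k\le n$. Let $a>0$, $\alpha<0$ and $\beta=0$. Then the problem $$c_{n,k}\,r^{1-n}\bigl(r^{n-k}(v'(r))^k\bigr)'+\alpha v(r)+\beta r v'(r)=0,\qquad v(r)>0,\qquad r\in(0,\infty),$$ $$v(0)=a,\qquad v'(0)=0,$$ has a solution in $(0,\infty)$.
   Context: Here $c_{n,k}=\frac1n\binom{n}{k}$, and prime denotes differentiation with respect to $r$. A solution on $(0,R)$, $0<R\le\infty$, of the initial value problem means a function $v\in C^1([0,R))\cap C^2((0,R))$ that is positive, satisfies the differential equation pointwise on $(0,R)$, and satisfies $v(0)=a$, $v'(0)=0$. *)

(* Defs.v *)
From Stdlib Require Import Reals ZArith Arith.
From Coquelicot Require Import Coquelicot.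
Open Scope R_scope.

(* [Binomial.C] is the real-valued binomial coefficient; the bare name [C]
   is shadowed by Coquelicot's complex numbers. *)
Definition c (n k : nat) : R := / INR n * Binomial.C n k.

Definition has_deriv_within (I : R -> Prop) (f : R -> R) (x l : R) : Prop :=
  filterlim (fun y => (f y - f x) / (y - x))
    (within (fun y => I y /\ y <> x) (locally x)) (locally l).

Definition C1_on (I : R -> Prop) (f : R -> R) : Prop :=
  exists f' : R -> R,
    (forall x, I x -> has_deriv_within I f x (f' x)) /\
    (forall x, I x -> filterlim f' (within I (locally x)) (locally (f' x))).

(* Two-sided derivatives, so meant for open [D].  All orders j <= 2 are listed
   because [ex_derive_n f 2 x] alone only says that the total function
   [Derive f] is differentiable at [x]. *)
Definition C2_on (D : R -> Prop) (f : R -> R) : Prop :=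
  forall x, D x -> forall j : nat, (j <= 2)%nat ->
    ex_derive_n f j x /\ continuous (Derive_n f j) x.

Definition Ico0 (rho : Rbar) (r : R) : Prop := 0 <= r /\ Rbar_lt r rho.
Definition Ioo0 (rho : Rbar) (r : R) : Prop := 0 < r /\ Rbar_lt r rho.

(* [n - k] is truncated, hence meant for k <= n; the exponent 1 - n is taken
   in Z since it may be negative. *)
Definition ode_at (n k : nat) (alpha beta : R) (v : R -> R) (r : R) : Prop :=
  c n k * powerRZ r (1 - Z.of_nat n)
    * Derive (fun s => s ^ (n - k) * Derive v s ^ k) r
  + alpha * v r + beta * r * Derive v r = 0.

(* Only the values of [v] on [0, rho) matter. *)
Definition is_solution (n k : nat) (alpha beta a : R) (rho : Rbar)
    (v : R -> R) : Prop :=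
  C1_on (Ico0 rho) v /\
  C2_on (Ioo0 rho) v /\
  (forall r, Ioo0 rho r -> 0 < v r) /\
  (forall r, Ioo0 rho r -> ode_at n k alpha beta v r) /\
  v 0 = a /\
  has_deriv_within (Ico0 rho) v 0 0.

(* Main.v *)
Require Import Defs.
From Stdlib Require Import Reals ZArith Arith Lra Lia.
From Coquelicot Require Import Coquelicot.
Open Scope R_scope.

(** Multiplied by [r^(n-1) / c n k], the equation with [beta = 0] says that the
    flux [r^(n-k) (v')^k] has derivative [kappa r^(n-1) v], where
    [kappa = - alpha / c n k > 0]. Integrating from [0], the flux at [r] is
    [kappa] times the integral of [x^(n-1) v(x)] over [0, r]. With [x = r s] that
    integral is [r^n M(r)], where [M(r)] is the integral of [s^(n-1) v(r s)] over
    [0 <= s <= 1], so the powers of [r] cancel and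

      [v'(r) = r (kappa M(r))^(1/k)].

    In this form nothing is singular at [r = 0], and the problem becomes the
    integral equation [v(r) = a + int_0^r t (kappa M(t))^(1/k) dt]
    ([radial_solution_exists]).

    The sign of [alpha] makes the slope nonnegative, so a solution stays above
    [a] and [M] stays above [a / n > 0]. On that range the [k]-th root is
    Lipschitz ([Rpower_lipschitz_away_from_0]). Replacing its argument by its
    maximum with [a / n] gives a globally Lipschitz nonlinearity without
    changing the solutions, and for such a nonlinearity the integral operator
    is a contraction on the whole half-line, for the sup norm weighted by
    [exp (- L r^2)] ([radial_integral_equation_solvable]). This is why the
    solution is global.

    Finally [M] is differentiable at every [r > 0], with derivative
    [(v - n M) / r] ([radial_mean_derive]), and [M > 0], so [v'] is continuously
    differentiable there, and differentiating the flux gives the equation back. *)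

(** * Moments of a dilated function *)

(** The moment over [0, t] is divided by its natural scale [t ^ S m] by
    dilating to the fixed interval [0, 1]: the quotient is then defined and
    continuous at [t = 0] as well. *)
Definition radial_mean (m : nat) (u : R -> R) (t : R) : R :=
  RInt (fun s => s ^ m * u (t * s)) 0 1.

Lemma ex_RInt_everywhere_continuous (f : R -> R) (x y : R) :
  (forall t, continuous f t) -> ex_RInt f x y.
Proof. intros Hf. apply (@ex_RInt_continuous R_CompleteNormedModule). auto. Qed.

Lemma continuous_pow (m : nat) (x : R) : continuous (fun s : R => s ^ m) x.
Proof. apply (@ex_derive_continuous R_AbsRing R_NormedModule). auto_derive. auto. Qed.

Lemma continuous_moment_integrand (m : nat) (u : R -> R) (t s : R) :
  (forall x, continuous u x) -> continuous (fun s => s ^ m * u (t * s)) s.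
Proof.
  intros Hu. apply (@continuous_mult R_UniformSpace R_AbsRing).
  - apply continuous_pow.
  - apply (continuous_comp (fun s => t * s) u).
    + apply (@ex_derive_continuous R_AbsRing R_NormedModule). auto_derive. auto.
    + apply Hu.
Qed.

(** The weight [s ^ m] is at most 1 on [0, 1], so a uniform bound on the
    integrands passes to the means. Two functions and two points are allowed to
    differ at once: [u = w] gives continuity, [t1 = t2] the Lipschitz
    dependence on the function. *)
Lemma radial_mean_close (m : nat) (u w : R -> R) (t1 t2 e : R) :
  (forall x, continuous u x) -> (forall x, continuous w x) ->
  (forall s, 0 <= s <= 1 -> Rabs (u (t1 * s) - w (t2 * s)) <= e) ->
  Rabs (radial_mean m u t1 - radial_mean m w t2) <= e.
Proof.
  intros Hu Hw He. unfold radial_mean.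
  assert (Iu := ex_RInt_everywhere_continuous _ 0 1
                  (fun s => continuous_moment_integrand m u t1 s Hu)).
  assert (Iw := ex_RInt_everywhere_continuous _ 0 1
                  (fun s => continuous_moment_integrand m w t2 s Hw)).
  eapply Rle_trans; [right; apply f_equal; symmetry;
    exact (RInt_minus (V := R_CompleteNormedModule) _ _ 0 1 Iu Iw) |].
  replace e with ((1 - 0) * e) by ring.
  apply abs_RInt_le_const; [lra | now apply @ex_RInt_minus |].
  intros s Hs. unfold minus, plus, opp; simpl.
  replace (s ^ m * u (t1 * s) + - (s ^ m * w (t2 * s)))
    with (s ^ m * (u (t1 * s) - w (t2 * s))) by ring.
  rewrite Rabs_mult.
  assert (0 <= s ^ m <= 1).
  { split; [apply pow_le; lra |]. rewrite <- (pow1 m). apply pow_incr; lra. }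
  rewrite (Rabs_pos_eq (s ^ m)) by lra.
  specialize (He s Hs).
  assert (0 <= Rabs (u (t1 * s) - w (t2 * s))) by apply Rabs_pos.
  nra.
Qed.

(** For [y] within 1 of [t], all the points [t s] and [y s] lie in one
    compact interval, on which [u] is uniformly continuous. *)
Lemma radial_mean_continuous (m : nat) (u : R -> R) (t : R) :
  (forall x, continuous u x) -> continuous (radial_mean m u) t.
Proof.
  intros Hu. apply continuity_pt_filterlim. intros eps Heps.
  destruct (Heine_cor2 (f := u) (a := - (Rabs t + 1)) (b := Rabs t + 1)
              (fun x _ => proj2 (continuity_pt_filterlim u x) (Hu x))
              (mkposreal (eps / 2) ltac:(lra))) as [d Hd].
  exists (Rmin 1 d). split.
  { apply Rmin_glb_lt; [lra | apply cond_pos]. }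
  intros y [_ Hy]. simpl in *. unfold R_dist in *.
  assert (H1 := Rmin_l 1 d). assert (H2 := Rmin_r 1 d).
  apply Rle_lt_trans with (eps / 2); [| lra].
  apply radial_mean_close; auto.
  intros s Hs.
  assert (Hts : forall z, Rabs z <= Rabs t + 1 ->
            - (Rabs t + 1) <= z * s <= Rabs t + 1).
  { intros z Hz. apply Rabs_le_between. rewrite Rabs_mult, (Rabs_pos_eq s) by lra.
    assert (0 <= Rabs z) by apply Rabs_pos. nra. }
  left. apply Hd.
  - apply Hts. replace y with (t + (y - t)) by ring.
    eapply Rle_trans; [apply Rabs_triang | lra].
  - apply Hts. lra.
  - replace (y * s - t * s) with ((y - t) * s) by ring.
    rewrite Rabs_mult, (Rabs_pos_eq s) by lra.
    assert (0 <= Rabs (y - t)) by apply Rabs_pos. nra.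
Qed.

Lemma radial_mean_scale (m : nat) (u : R -> R) (t : R) :
  (forall x, continuous u x) ->
  t ^ S m * radial_mean m u t = RInt (fun x => x ^ m * u x) 0 t.
Proof.
  intros Hu. unfold radial_mean.
  assert (Hf : forall x, continuous (fun x => x ^ m * u x) x).
  { intros x. apply (@continuous_mult R_UniformSpace R_AbsRing).
    - apply continuous_pow.
    - apply Hu. }
  assert (H := RInt_comp_lin (V := R_CompleteNormedModule)
                 (fun x => x ^ m * u x) t 0 0 1
                 (ex_RInt_everywhere_continuous _ _ _ Hf)).
  replace (t * 0 + 0) with 0 in H by ring.
  replace (t * 1 + 0) with t in H by ring.
  rewrite <- H.
  rewrite <- (RInt_scal (V := R_CompleteNormedModule)).
  - apply RInt_ext. intros s _. unfold scal; simpl; unfold mult; simpl.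
    rewrite !Rplus_0_r, Rpow_mult_distr. ring.
  - apply ex_RInt_everywhere_continuous. intros s.
    now apply continuous_moment_integrand.
Qed.

Lemma radial_mean_ge (m : nat) (u : R -> R) (a t : R) :
  (forall x, continuous u x) -> (forall x, a <= u x) ->
  a / INR (S m) <= radial_mean m u t.
Proof.
  intros Hu Ha. unfold radial_mean.
  assert (HS : 0 < INR (S m)) by (apply lt_0_INR; lia).
  assert (H : is_RInt (fun s => s ^ m * a) 0 1 (a / INR (S m))).
  { replace (a / INR (S m))
      with (1 ^ S m * a / INR (S m) - 0 ^ S m * a / INR (S m))
      by (rewrite pow1, pow_i by lia; field; lra).
    apply (@is_RInt_derive R_CompleteNormedModule
             (fun s => s ^ S m * a / INR (S m)) (fun s => s ^ m * a)).
    - intros x _. auto_derive; [auto |]. change (Nat.pred (S m)) with m.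
      change (1 * (INR (S m) * x ^ m) * a * / INR (S m) = x ^ m * a).
      field. lra.
    - intros x _. apply (@ex_derive_continuous R_AbsRing R_NormedModule).
      auto_derive. auto. }
  rewrite <- (is_RInt_unique _ _ _ _ H).
  apply RInt_le; [lra | now exists (a / INR (S m)) | |].
  - apply ex_RInt_everywhere_continuous. intros s.
    now apply continuous_moment_integrand.
  - intros s Hs. apply Rmult_le_compat_l; [apply pow_le; lra | apply Ha].
Qed.

(** * Picard iteration in a weighted norm *)

(** The factor [t] is, up to [2 L], the logarithmic derivative of the weight, so
    one integration gains [1 / (2 L)] for the weighted norm. The upper limit is
    [Rabs r] so that the operators built from this integral act on functions on
    the whole line. *)
Lemma weighted_primitive_bound (h : R -> R) (L P r : R) :
  0 < L -> 0 <= P -> (forall t, continuous h t) ->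
  (forall t, 0 <= t -> Rabs (h t) <= P * exp (L * t ^ 2)) ->
  Rabs (RInt (fun t => t * h t) 0 (Rabs r)) <= P / (2 * L) * exp (L * r ^ 2).
Proof.
  intros HL HP Hh Hb.
  set (F := fun t => P / (2 * L) * exp (L * t ^ 2)).
  assert (HF : is_RInt (fun t => t * (P * exp (L * t ^ 2))) 0 (Rabs r)
                 (minus (F (Rabs r)) (F 0))).
  { apply (@is_RInt_derive R_CompleteNormedModule F).
    - intros x _. unfold F. auto_derive; [auto |]. simpl. field. lra.
    - intros x _. apply (@ex_derive_continuous R_AbsRing R_NormedModule).
      auto_derive. auto. }
  assert (Hc : forall t, continuous (fun t => t * h t) t).
  { intros t. apply (@continuous_mult R_UniformSpace R_AbsRing); auto.
    apply continuous_id. }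
  apply Rle_trans with (minus (F (Rabs r)) (F 0)).
  - eapply (norm_RInt_le (V := R_CompleteNormedModule));
      [apply Rabs_pos | | apply RInt_correct; now apply ex_RInt_everywhere_continuous
      | exact HF].
    intros x [Hx _]. change (norm (x * h x)) with (Rabs (x * h x)).
    rewrite Rabs_mult, (Rabs_pos_eq x Hx). apply Rmult_le_compat_l; auto.
  - change (F (Rabs r) - F 0 <= F r). unfold F.
    replace (Rabs r ^ 2) with (r ^ 2) by (symmetry; apply pow2_abs).
    assert (0 <= P / (2 * L) * exp (L * 0 ^ 2)).
    { apply Rmult_le_pos; [| left; apply exp_pos].
      apply Rmult_le_pos; [lra |]. left; apply Rinv_0_lt_compat; lra. }
    lra.
Qed.

(** Banach's fixed point argument for the distance
    [sup |u x - w x| / W x], which may be infinite between two arbitrary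
    continuous functions but is at most [D] between [u0] and its image. As [W]
    is locally bounded, the iterates converge locally uniformly, which keeps
    the limit continuous. *)
Lemma weighted_contraction_fixpoint (W : R -> R) (T : (R -> R) -> R -> R)
    (u0 : R -> R) (D : R) :
  0 <= D -> (forall x, 0 < W x) -> (forall x, continuous W x) ->
  (forall u, (forall x, continuous u x) -> forall x, continuous (T u) x) ->
  (forall u w d, 0 <= d ->
     (forall x, continuous u x) -> (forall x, continuous w x) ->
     (forall x, Rabs (u x - w x) <= d * W x) ->
     forall x, Rabs (T u x - T w x) <= d / 2 * W x) ->
  (forall x, continuous u0 x) ->
  (forall x, Rabs (T u0 x - u0 x) <= D * W x) ->
  exists v : R -> R, (forall x, continuous v x) /\ forall x, T v x = v x.
Proof.
  intros HD HWp HWc HTc HT H0c H0.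
  set (u := fun m : nat => Nat.iter m T u0).
  assert (Huc : forall m x, continuous (u m) x).
  { induction m; [exact H0c |]. exact (HTc _ IHm). }
  assert (Hp : forall m, 0 < (/ 2) ^ m) by (intros m; apply pow_lt; lra).
  assert (Hstep : forall m x, Rabs (u (S m) x - u m x) <= D * (/ 2) ^ m * W x).
  { induction m; intros x.
    - rewrite pow_O, Rmult_1_r. apply H0.
    - replace (D * (/ 2) ^ S m) with (D * (/ 2) ^ m / 2) by (simpl; field).
      apply (HT (u (S m)) (u m)); auto. specialize (Hp m). nra. }
  assert (Hcau : forall m p x,
             Rabs (u (m + p)%nat x - u m x) <= 2 * D * (/ 2) ^ m * W x).
  { intros m p x.
    (* The exact sum of the p geometric steps is what the induction carries. *)
    apply Rle_trans with (2 * D * (/ 2) ^ m * (1 - (/ 2) ^ p) * W x).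
    - induction p.
      + rewrite Nat.add_0_r, Rminus_diag, Rabs_R0. simpl. lra.
      + rewrite Nat.add_succ_r.
        replace (u (S (m + p)) x - u m x)
          with ((u (S (m + p)) x - u (m + p)%nat x) + (u (m + p)%nat x - u m x))
          by ring.
        eapply Rle_trans; [apply Rabs_triang |].
        specialize (Hstep (m + p)%nat x). rewrite pow_add in Hstep.
        simpl ((/ 2) ^ S p). lra.
    - specialize (HWp x). assert (Hpp := Hp p). specialize (Hp m).
      assert (0 <= D * (/ 2) ^ m) by nra.
      assert (0 <= D * (/ 2) ^ m * W x) by nra.
      nra. }
  assert (Hsmall : forall C eps, 0 < eps ->
             exists N, forall m, (N <= m)%nat -> C * (/ 2) ^ m < eps).
  { intros C eps Heps.
    assert (HC : 0 < Rabs C + 1) by (assert (h := Rabs_pos C); lra).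
    destruct (pow_lt_1_zero (/ 2)) with (y := eps / (Rabs C + 1)) as [N HN].
    - rewrite Rabs_pos_eq; lra.
    - now apply Rdiv_lt_0_compat.
    - exists N. intros m Hm. specialize (HN m Hm).
      rewrite Rabs_pos_eq in HN by (left; apply Hp).
      apply Rlt_div_r in HN; [| lra].
      assert (h := Rle_abs C). specialize (Hp m). nra. }
  set (v := fun x => real (Lim_seq (fun m => u m x))).
  assert (Hlim : forall x, is_lim_seq (fun m => u m x) (v x)).
  { intros x. apply Lim_seq_correct'. apply ex_lim_seq_cauchy_corr.
    intros eps. destruct (Hsmall (4 * D * W x) eps (cond_pos eps)) as [N HN].
    exists N. intros p q Hp1 Hq1.
    assert (HNN := HN N (le_n N)).
    assert (H1 := Hcau N (p - N)%nat x). assert (H2 := Hcau N (q - N)%nat x).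
    replace (N + (p - N))%nat with p in H1 by lia.
    replace (N + (q - N))%nat with q in H2 by lia.
    replace (u p x - u q x) with ((u p x - u N x) - (u q x - u N x)) by ring.
    eapply Rle_lt_trans; [apply Rabs_triang |]. rewrite Rabs_Ropp. lra. }
  assert (Herr : forall m x, Rabs (v x - u m x) <= 2 * D * (/ 2) ^ m * W x).
  { intros m x.
    apply (is_lim_seq_le (fun p => Rabs (u (p + m)%nat x - u m x))
             (fun _ => 2 * D * (/ 2) ^ m * W x)
             (Rabs (v x - u m x)) (2 * D * (/ 2) ^ m * W x)).
    - intros p. rewrite Nat.add_comm. apply Hcau.
    - apply (is_lim_seq_abs _ (v x - u m x)).
      apply is_lim_seq_minus'; [| apply is_lim_seq_const].
      apply (is_lim_seq_incr_n (fun p => u p x)). apply Hlim.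
    - apply is_lim_seq_const. }
  assert (Hvc : forall x, continuous v x).
  { intros x. apply continuity_pt_filterlim.
    destruct (proj1 (filterlim_locally W (W x)) (HWc x) (mkposreal 1 Rlt_0_1))
      as [d Hd].
    apply (CVU_continuity u v x d).
    - intros eps Heps.
      destruct (Hsmall (2 * D * (W x + 1)) eps Heps) as [N HN].
      exists N. intros m y Hm Hy.
      eapply Rle_lt_trans; [apply Herr |].
      eapply Rle_lt_trans; [| apply (HN m Hm)].
      specialize (Hd y Hy). apply Rabs_lt_between' in Hd. simpl in Hd.
      specialize (Hp m). assert (0 <= D * (/ 2) ^ m) by nra. nra.
    - intros m y _. apply continuity_pt_filterlim, Huc.
    - unfold Boule. rewrite Rminus_diag, Rabs_R0. apply cond_pos. }
  (* Both T v and v are close to the iterate u (S N). *)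
  exists v. split; [exact Hvc |].
  intros x. apply Rminus_diag_uniq.
  apply cond_eq. intros eps Heps. rewrite Rminus_0_r.
  destruct (Hsmall (2 * D * W x) eps Heps) as [N HN]. specialize (HN N (le_n N)).
  assert (H1 : Rabs (T v x - u (S N) x) <= 2 * D * (/ 2) ^ N / 2 * W x).
  { apply (HT v (u N)); auto. specialize (Hp N). nra. }
  assert (H2 := Herr (S N) x). rewrite Rabs_minus_sym in H2. simpl pow in H2.
  replace (T v x - v x) with ((T v x - u (S N) x) + (u (S N) x - v x)) by ring.
  eapply Rle_lt_trans; [apply Rabs_triang |]. lra.
Qed.

(** * The integral equation *)

Lemma exp_monotone (x y : R) : x <= y -> exp x <= exp y.
Proof. intros [H | ->]; [left; now apply exp_increasing | right; reflexivity]. Qed.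

Lemma lipschitz_continuous (f : R -> R) (L : R) :
  (forall x y, Rabs (f x - f y) <= L * Rabs (x - y)) -> forall x, continuous f x.
Proof.
  intros HL x. apply continuity_pt_filterlim. intros eps Heps.
  assert (0 < Rabs L + 1) by (assert (h := Rabs_pos L); lra).
  exists (eps / (Rabs L + 1)). split; [now apply Rdiv_lt_0_compat |].
  intros y [_ Hy]. simpl in *. unfold R_dist in *.
  apply Rlt_div_r in Hy; [| lra].
  assert (h := HL y x). assert (h1 := Rle_abs L). assert (h2 := Rabs_pos (y - x)).
  nra.
Qed.

Lemma Rmax_l_contracting (b x y : R) : Rabs (Rmax b x - Rmax b y) <= Rabs (x - y).
Proof.
  unfold Rmax. destruct (Rle_dec b x), (Rle_dec b y);
    unfold Rabs; repeat destruct Rcase_abs; lra.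
Qed.

Lemma continuous_Rmax_l (b x : R) : continuous (Rmax b) x.
Proof.
  apply (lipschitz_continuous (Rmax b) 1).
  intros y z. rewrite Rmult_1_l. apply Rmax_l_contracting.
Qed.

Lemma is_derive_RInt_upper (f : R -> R) (c x : R) :
  (forall t, continuous f t) -> is_derive (fun y => RInt f c y) x (f x).
Proof.
  intros Hf. apply (is_derive_RInt f _ c); [| apply Hf].
  apply filter_forall. intros y. apply (@RInt_correct R_CompleteNormedModule).
  now apply ex_RInt_everywhere_continuous.
Qed.

(** If [u] and [w] differ by at most [d] times the weight [exp (L r^2)], so do
    their means, because the weight is even and increasing in [Rabs r]. The
    nonlinearity multiplies this by [L], and the integration against [t]
    divides it by [2 L]: the operator halves weighted distances, whatever the
    Lipschitz constant. *)
Lemma radial_integral_equation_solvable (m : nat) (Psi : R -> R) (L a : R) :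
  0 < L -> (forall x y, Rabs (Psi x - Psi y) <= L * Rabs (x - y)) ->
  exists v : R -> R, (forall x, continuous v x) /\
    forall r, v r = a + RInt (fun t => t * Psi (radial_mean m v t)) 0 (Rabs r).
Proof.
  intros HL HPsi.
  assert (HPc := lipschitz_continuous Psi L HPsi).
  set (T := fun u r => a + RInt (fun t => t * Psi (radial_mean m u t)) 0 (Rabs r)).
  assert (Hmc : forall u, (forall x, continuous u x) ->
            forall t, continuous (fun t => Psi (radial_mean m u t)) t).
  { intros u Hu t. apply (continuous_comp (radial_mean m u) Psi); auto.
    now apply radial_mean_continuous. }
  assert (Hic : forall u, (forall x, continuous u x) ->
            forall t, continuous (fun t => t * Psi (radial_mean m u t)) t).
  { intros u Hu t. apply (@continuous_mult R_UniformSpace R_AbsRing).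
    - apply continuous_id.
    - now apply Hmc. }
  set (Q := Psi (radial_mean m (fun _ => a) 0)).
  destruct (weighted_contraction_fixpoint (fun r => exp (L * r ^ 2)) T (fun _ => a)
              (Rabs Q / (2 * L))) as [v [Hvc Hv]].
  - apply Rmult_le_pos; [apply Rabs_pos |]. left. apply Rinv_0_lt_compat. lra.
  - intros x. apply exp_pos.
  - intros x. apply (@ex_derive_continuous R_AbsRing R_NormedModule).
    auto_derive. auto.
  - intros u Hu x. unfold T.
    apply (@continuous_plus R_UniformSpace R_AbsRing R_NormedModule).
    + apply continuous_const.
    + apply (continuous_comp Rabs
               (fun y => RInt (fun t => t * Psi (radial_mean m u t)) 0 y)).
      * apply continuous_Rabs.
      * apply (@ex_derive_continuous R_AbsRing R_NormedModule).
        eexists. apply is_derive_RInt_upper. now apply Hic.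
  - intros u w d Hd Hu Hw Huw x. unfold T.
    assert (Iu := ex_RInt_everywhere_continuous _ 0 (Rabs x) (Hic u Hu)).
    assert (Iw := ex_RInt_everywhere_continuous _ 0 (Rabs x) (Hic w Hw)).
    match goal with |- Rabs (a + ?A - (a + ?B)) <= _ =>
      replace (a + A - (a + B)) with (A - B) by ring end.
    eapply Rle_trans; [right; apply f_equal; symmetry;
      exact (RInt_minus (V := R_CompleteNormedModule) _ _ 0 (Rabs x) Iu Iw) |].
    rewrite (RInt_ext (V := R_CompleteNormedModule) _
               (fun t => t * (Psi (radial_mean m u t) - Psi (radial_mean m w t)))).
    2: { intros t _. unfold minus, plus, opp; simpl. ring. }
    replace (d / 2) with (L * d / (2 * L)) by (field; lra).
    apply weighted_primitive_bound; [exact HL | nra | |].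
    + intros t. apply (@continuous_minus R_UniformSpace R_AbsRing R_NormedModule);
        now apply Hmc.
    + intros t Ht. eapply Rle_trans; [apply HPsi |].
      rewrite Rmult_assoc. apply Rmult_le_compat_l; [lra |].
      apply radial_mean_close; auto.
      intros s Hs. eapply Rle_trans; [apply Huw |].
      apply Rmult_le_compat_l; [exact Hd |].
      apply exp_monotone. apply Rmult_le_compat_l; [lra |].
      apply pow_incr. nra.
  - intros x. apply continuous_const.
  (* The means of the constant a do not depend on the point, so the first
     Picard step is a multiple of r ^ 2. *)
  - intros x. unfold T. ring_simplify (a + RInt (fun t =>
      t * Psi (radial_mean m (fun _ => a) t)) 0 (Rabs x) - a).
    apply (weighted_primitive_bound (fun _ => Q)); [exact HL | apply Rabs_pos | |].
    + intros t. apply continuous_const.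
    + intros t Ht. rewrite <- (Rmult_1_r (Rabs Q)) at 1.
      apply Rmult_le_compat_l; [apply Rabs_pos |].
      rewrite <- exp_0 at 1. apply exp_monotone.
      apply Rmult_le_pos; [lra | apply pow2_ge_0].
  - exists v. split; [exact Hvc |]. intros r. symmetry. apply Hv.
Qed.

Lemma is_derive_Rpower_l (p x : R) :
  0 < x -> is_derive (fun y => Rpower y p) x (p * Rpower x (p - 1)).
Proof. intros Hx. apply is_derive_Reals. now apply derivable_pt_lim_power. Qed.

(** For [p <= 1] the derivative [p * Rpower z (p - 1)] is nonincreasing in [z], so
    the mean value theorem bounds the slope by its value at [b]. *)
Lemma Rpower_lipschitz_away_from_0 (p b x y : R) :
  0 <= p <= 1 -> 0 < b -> b <= x -> b <= y ->
  Rabs (Rpower x p - Rpower y p) <= p * Rpower b (p - 1) * Rabs (x - y).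
Proof.
  intros Hp Hb Hx Hy.
  destruct (MVT_gen (fun z => Rpower z p) y x (fun z => p * Rpower z (p - 1)))
    as [z [Hz E]].
  - intros z Hz. apply is_derive_Rpower_l.
    assert (h := Rmin_glb _ _ _ Hy Hx). lra.
  - intros z Hz. apply continuity_pt_filterlim.
    apply (@ex_derive_continuous R_AbsRing R_NormedModule (fun z => Rpower z p)).
    eexists. apply is_derive_Rpower_l.
    assert (h := Rmin_glb _ _ _ Hy Hx). lra.
  - rewrite E, Rabs_mult. apply Rmult_le_compat_r; [apply Rabs_pos |].
    assert (Hbz : b <= z) by (assert (h := Rmin_glb _ _ _ Hy Hx); lra).
    rewrite Rabs_pos_eq.
    2: { apply Rmult_le_pos; [lra |]. left. apply exp_pos. }
    apply Rmult_le_compat_l; [lra |].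
    replace (p - 1) with (- (1 - p)) by ring. rewrite !Rpower_Ropp.
    apply Rinv_le_contravar; [apply exp_pos |].
    apply Rle_Rpower_l; lra.
Qed.

(** The nonlinearity is truncated below the level [b = a / S m]. Since it stays
    nonnegative, the solution of the truncated equation is at least [a], its
    means are at least [b], and the truncation is never active. *)
Lemma radial_solution_exists (m : nat) (K p a : R) :
  0 < K -> 0 < p <= 1 -> 0 < a ->
  exists v : R -> R, (forall x, continuous v x) /\ (forall x, a <= v x) /\
    forall r, 0 <= r ->
      v r = a + RInt (fun t => t * (K * Rpower (radial_mean m v t) p)) 0 r.
Proof.
  intros HK Hp Ha.
  assert (HS : 0 < INR (S m)) by (apply lt_0_INR; lia).
  set (b := a / INR (S m)).
  assert (Hb : 0 < b) by now apply Rdiv_lt_0_compat.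
  set (Psi := fun x => K * Rpower (Rmax b x) p).
  set (L := K * (p * Rpower b (p - 1))).
  assert (HL : 0 < L).
  { apply Rmult_lt_0_compat; [exact HK |].
    apply Rmult_lt_0_compat; [lra | apply exp_pos]. }
  destruct (radial_integral_equation_solvable m Psi L a) as [v [Hvc Hv]].
  - exact HL.
  - intros x y. unfold Psi, L. rewrite <- Rmult_minus_distr_l, Rabs_mult.
    rewrite (Rabs_pos_eq K) by lra. rewrite Rmult_assoc.
    apply Rmult_le_compat_l; [lra |].
    eapply Rle_trans.
    + apply (Rpower_lipschitz_away_from_0 p b); [lra | exact Hb | |]; apply Rmax_l.
    + apply Rmult_le_compat_l; [| apply Rmax_l_contracting].
      apply Rmult_le_pos; [lra |]. left. apply exp_pos.
  - assert (Hcont : forall t, continuous (fun t => t * Psi (radial_mean m v t)) t).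
    { intros t. apply (@continuous_mult R_UniformSpace R_AbsRing);
        [apply continuous_id |].
      apply (continuous_comp (radial_mean m v) Psi);
        [now apply radial_mean_continuous |].
      apply (@continuous_mult R_UniformSpace R_AbsRing); [apply continuous_const |].
      apply (continuous_comp (Rmax b) (fun y => Rpower y p));
        [apply continuous_Rmax_l |].
      apply (@ex_derive_continuous R_AbsRing R_NormedModule).
      eexists. apply (is_derive_Rpower_l p).
      eapply Rlt_le_trans; [exact Hb | apply Rmax_l]. }
    assert (Hva : forall x, a <= v x).
    { intros x. rewrite Hv.
      assert (0 <= RInt (fun t => t * Psi (radial_mean m v t)) 0 (Rabs x)); [| lra].
      apply RInt_ge_0; [apply Rabs_pos | now apply ex_RInt_everywhere_continuous |].
      intros t Ht. apply Rmult_le_pos; [lra |].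
      apply Rmult_le_pos; [lra |]. left. apply exp_pos. }
    exists v. split; [exact Hvc |]. split; [exact Hva |].
    intros r Hr. rewrite Hv at 1. rewrite Rabs_pos_eq by exact Hr. f_equal.
    apply RInt_ext. intros t _. unfold Psi.
    rewrite Rmax_right; [reflexivity |].
    now apply radial_mean_ge.
Qed.

(** * From the integral equation to the differential equation *)

Lemma is_derive_has_deriv_within (I : R -> Prop) (f : R -> R) (x l : R) :
  is_derive f x l -> has_deriv_within I f x l.
Proof.
  intros Hf. apply is_derive_Reals in Hf. apply filterlim_locally. intros eps.
  destruct (Hf eps (cond_pos eps)) as [d Hd]. exists d.
  intros y Hy [_ Hyx].
  specialize (Hd (y - x)). rewrite Rplus_minus in Hd.
  apply Hd; [lra | exact Hy].
Qed.

(** Away from [0] the mean is a quotient of the primitive of [x ^ m * u x] by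
    [x ^ S m]. *)
Lemma radial_mean_derive (m : nat) (u : R -> R) (s : R) :
  (forall x, continuous u x) -> 0 < s ->
  is_derive (radial_mean m u) s ((u s - INR (S m) * radial_mean m u s) / s).
Proof.
  intros Hu Hs.
  set (I := fun t => RInt (fun x => x ^ m * u x) 0 t).
  assert (HI : is_derive I s (s ^ m * u s)).
  { apply (is_derive_RInt_upper (fun x => x ^ m * u x)). intros t.
    apply (@continuous_mult R_UniformSpace R_AbsRing); [apply continuous_pow | auto]. }
  apply (is_derive_ext_loc (fun t => I t / t ^ S m)).
  - exists (mkposreal s Hs). intros t Ht. apply Rabs_lt_between' in Ht. simpl in Ht.
    unfold I. rewrite <- radial_mean_scale by exact Hu.
    change (t ^ S m * radial_mean m u t / t ^ S m = radial_mean m u t :> R).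
    field. apply pow_nonzero. lra.
  - assert (Hsm : s ^ m <> 0) by (apply pow_nonzero; lra).
    replace ((u s - INR (S m) * radial_mean m u s) / s)
      with ((s ^ m * u s * s ^ S m - I s * (INR (S m) * s ^ m)) / (s ^ S m) ^ 2).
    + apply is_derive_div; [exact HI | | now apply pow_nonzero, Rgt_not_eq].
      apply is_derive_Reals. apply derivable_pt_lim_pow.
    + unfold I. rewrite <- radial_mean_scale by exact Hu.
      rewrite <- tech_pow_Rmult. field. split; [lra | exact Hsm].
Qed.

Lemma coefficient_pos (n k : nat) : (1 <= n)%nat -> 0 < c n k.
Proof.
  intros hn. unfold c, Binomial.C.
  apply Rmult_lt_0_compat; [apply Rinv_0_lt_compat, lt_0_INR; lia |].
  apply Rdiv_lt_0_compat; [| apply Rmult_lt_0_compat]; apply INR_fact_lt_0.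
Qed.

Theorem lemma2p2 (n k : nat) (alpha beta a : R)
    (hn : (1 <= n)%nat) (hk_odd : Nat.Odd k) (hk : (1 <= k <= n)%nat)
    (ha : 0 < a) (halpha : alpha < 0) (hbeta : beta = 0) :
  exists v : R -> R, is_solution n k alpha beta a p_infty v.
Proof.
  destruct n as [| m]; [lia |].
  assert (Hc := coefficient_pos (S m) k hn).
  set (kappa := - alpha / c (S m) k).
  assert (Hkappa : 0 < kappa) by (apply Rdiv_lt_0_compat; lra).
  assert (Hk1 : 1 <= INR k) by (apply (le_INR 1); lia).
  set (p := / INR k).
  assert (Hp : 0 < p <= 1).
  { split; [apply Rinv_0_lt_compat; lra |].
    unfold p. rewrite <- Rinv_1. apply Rinv_le_contravar; lra. }
  (* The k-th root of kappa x is split as K times the k-th root of x. *)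
  set (K := Rpower kappa p).
  assert (Hroot : forall x, 0 < x -> Rpower x p ^ k = x).
  { intros x Hx. rewrite <- Rpower_pow by apply exp_pos.
    rewrite Rpower_mult. unfold p. rewrite Rinv_l by lra. now apply Rpower_1. }
  destruct (radial_solution_exists m K p a) as [v [Hvc [Hva Hv]]];
    [apply exp_pos | exact Hp | exact ha |].
  set (M := radial_mean m v) in *.
  assert (HMc : forall t, continuous M t)
    by (intros t; now apply radial_mean_continuous).
  assert (HMp : forall t, 0 < M t).
  { intros t. apply Rlt_le_trans with (a / INR (S m)).
    - apply Rdiv_lt_0_compat; [exact ha | apply lt_0_INR; lia].
    - now apply radial_mean_ge. }
  set (g := fun t => K * Rpower (M t) p).
  assert (Hgc : forall t, continuous g t).
  { intros t. apply (@continuous_mult R_UniformSpace R_AbsRing);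
      [apply continuous_const |].
    apply (continuous_comp M (fun y => Rpower y p)); [apply HMc |].
    apply (@ex_derive_continuous R_AbsRing R_NormedModule (fun y => Rpower y p)).
    eexists. apply is_derive_Rpower_l. apply HMp. }
  set (f1 := fun t => t * g t).
  assert (Hf1c : forall t, continuous f1 t).
  { intros t. apply (@continuous_mult R_UniformSpace R_AbsRing);
      [apply continuous_id | apply Hgc]. }
  set (f2 := fun t => g t + p * g t * (v t - INR (S m) * M t) / M t).
  assert (Hf2c : forall t, continuous f2 t).
  { intros t. apply (@continuous_plus R_UniformSpace R_AbsRing R_NormedModule);
      [apply Hgc |].
    apply (@continuous_mult R_UniformSpace R_AbsRing).
    - apply (@continuous_mult R_UniformSpace R_AbsRing).
      + apply (@continuous_mult R_UniformSpace R_AbsRing);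
          [apply continuous_const | apply Hgc].
      + apply (@continuous_minus R_UniformSpace R_AbsRing R_NormedModule);
          [apply Hvc |].
        apply (@continuous_mult R_UniformSpace R_AbsRing);
          [apply continuous_const | apply HMc].
    - apply continuous_Rinv_comp; [apply HMc | apply Rgt_not_eq, HMp]. }
  assert (Hf1' : forall t, 0 < t -> is_derive f1 t (f2 t)).
  { intros t Ht.
    assert (HM' := radial_mean_derive m v t Hvc Ht).
    assert (HR := is_derive_Rpower_l p (M t) (HMp t)).
    assert (HMt := HMp t).
    assert (Hg' : is_derive g t (p * g t * (v t - INR (S m) * M t) / (t * M t))).
    { replace (p * g t * (v t - INR (S m) * M t) / (t * M t))
        with (K * ((v t - INR (S m) * M t) / t * (p * Rpower (M t) (p - 1)))).
      - apply is_derive_scal.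
        apply (is_derive_comp (fun y => Rpower y p) M); [exact HR | exact HM'].
      - unfold g, Rminus at 2. rewrite Rpower_plus, Rpower_Ropp, Rpower_1 by exact HMt.
        field. lra. }
    replace (f2 t) with (1 * g t + t * (p * g t * (v t - INR (S m) * M t) / (t * M t)))
      by (unfold f2; field; lra).
    apply (is_derive_mult (fun t => t) g);
      [exact (@is_derive_id R_AbsRing t) | exact Hg' | intros; apply Rmult_comm]. }
  (* The integral equation for v holds only on the half-line. Its right-hand side
     is differentiable on the whole line, with derivative f1 on both sides of 0. *)
  set (w := fun r => a + RInt f1 0 r).
  assert (Hw' : forall r, is_derive w r (f1 r)).
  { intros r. unfold w. rewrite <- (Rplus_0_l (f1 r)).
    apply @is_derive_plus; [apply @is_derive_const | now apply is_derive_RInt_upper]. }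
  assert (HDw : forall r, Derive w r = f1 r) by (intros r; now apply is_derive_unique).
  assert (Hwv : forall r, 0 <= r -> w r = v r)
    by (intros r Hr; symmetry; now apply Hv).
  assert (HD2w : forall r, 0 < r -> is_derive (Derive_n w 1) r (f2 r)).
  { intros r Hr. apply (is_derive_ext f1); [intros t; symmetry; apply HDw |].
    now apply Hf1'. }
  assert (Hw0 : w 0 = a) by (unfold w; rewrite RInt_point; apply Rplus_0_r).
  exists w. repeat split.
  - exists f1. split.
    + intros x _. apply is_derive_has_deriv_within, Hw'.
    + intros x _. eapply filterlim_filter_le_1; [apply filter_le_within | apply Hf1c].
  - destruct H as [Hx _]. destruct j as [| [| [| j]]]; [exact I | | | lia].
    + exists (f1 x). apply Hw'.
    + exists (f2 x). now apply HD2w.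
  - destruct H as [Hx _]. destruct j as [| [| [| j]]]; [| | | lia].
    + apply (@ex_derive_continuous R_AbsRing R_NormedModule w).
      exists (f1 x). apply Hw'.
    + apply (continuous_ext f1); [intros t; symmetry; apply HDw | apply Hf1c].
    + apply (continuous_ext_loc _ f2); [| apply Hf2c].
      exists (mkposreal x Hx). intros t Ht.
      apply Rabs_lt_between' in Ht. simpl in Ht.
      symmetry. apply is_derive_unique. apply HD2w. lra.
  - intros r [Hr _]. rewrite Hwv by lra. now apply Rlt_le_trans with a.
  - intros r [Hr _]. unfold ode_at.
    (* The k-th power undoes the root, and s ^ (n - k) s ^ k restores the scale
       s ^ n of the moment. *)
    assert (Hflux : forall s, s ^ (S m - k) * Derive w s ^ k
                              = kappa * RInt (fun x => x ^ m * v x) 0 s).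
    { intros s. rewrite HDw. unfold f1, g.
      rewrite !Rpow_mult_distr, Hroot by apply HMp.
      unfold K. rewrite Hroot by exact Hkappa.
      rewrite <- radial_mean_scale by exact Hvc. fold (M s).
      rewrite <- Rmult_assoc, <- pow_add.
      replace (S m - k + k)%nat with (S m) by lia. ring. }
    assert (Hflux' : Derive (fun s => s ^ (S m - k) * Derive w s ^ k) r
                     = kappa * (r ^ m * v r)).
    { apply is_derive_unique. eapply is_derive_ext; [intros s; symmetry; apply Hflux |].
      apply is_derive_scal.
      apply (is_derive_RInt_upper (fun x => x ^ m * v x)). intros t.
      apply (@continuous_mult R_UniformSpace R_AbsRing);
        [apply continuous_pow | apply Hvc]. }
    rewrite Hflux'.
    rewrite Hwv by lra. rewrite hbeta.
    replace (1 - Z.of_nat (S m))%Z with (- Z.of_nat m)%Z by lia.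
    rewrite powerRZ_neg', <- pow_powerRZ.
    unfold kappa. field. split; [lra | apply pow_nonzero; lra].
  - exact Hw0.
  - apply is_derive_has_deriv_within.
    replace 0 with (f1 0) at 2 by apply Rmult_0_l. apply Hw'.
Qed.
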